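(* If $P$ is a simple closed $n$-gon ($n\ge3$) in $\mathbb{R}^2$, then $\mathrm{poldiam}(\mathrm{int}P)\le\lfloor n/2\rfloor+3$ and $\mathrm{poldiam}(\mathrm{ext}P)\le\lfloor n/2\rfloor+3$.
   Context: A simple closed $n$-gon is $P=\bigcup_{i=1}^n[p_{i-1},p_i]$ with distinct vertices $p_0,\dots,p_{n-1}$, $p_n=p_0$, whose edges meet only in common endpoints of consecutive edges. $\mathbb{R}^2\setminus P$ is the disjoint union of the bounded open set $\mathrm{int}P$ and the unbounded open set $\mathrm{ext}P$ (its two components). For $S\subset\mathbb{R}^2$ and $a,b\in S$, $\pi_S(a,b)$ is the smallest number of edges of a polygonal path connecting $a$ to $b$ within $S$ ($\infty$ if none exists), and $\mathrm{poldiam}(S)=\sup\{\pi_S(a,b):a,b\in S\}$. *)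

(* Defs.v *)
From HB Require Import structures.
From mathcomp Require Import all_boot all_order all_algebra.
From mathcomp Require Import all_classical all_reals all_analysis.
Set Implicit Arguments. Unset Strict Implicit. Unset Printing Implicit Defensive.
Import Order.TTheory GRing.Theory Num.Theory.
Import numFieldNormedType.Exports.
Local Open Scope classical_set_scope.
Local Open Scope ring_scope.

Section Defs.
Variable R : realType.
Notation pt := (R * R)%type.

Definition segment (a b : pt) : set pt :=
  [set x | exists t : R, 0 <= t <= 1 /\
     x = ((1 - t) * a.1 + t * b.1, (1 - t) * a.2 + t * b.2)].

Definition edge (n : nat) (p : nat -> pt) (i : nat) : set pt :=
  segment (p i) (p (i.+1 %% n)%N).

Definition polygon (n : nat) (p : nat -> pt) : set pt :=
  \bigcup_(i in [set i : nat | (i < n)%N]) edge n p i.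

Definition simple_closed_polygon (n : nat) (p : nat -> pt) : Prop :=
  (forall i j, (i < n)%N -> (j < n)%N -> p i = p j -> i = j) /\
  (forall i j, (i < n)%N -> (j < n)%N -> i <> j ->
     forall x, edge n p i x -> edge n p j x ->
       (j = (i.+1 %% n)%N /\ x = p j) \/ (i = (j.+1 %% n)%N /\ x = p i)).

Definition bounded_set2 (A : set pt) : Prop :=
  exists M : R, forall x, A x -> `|x.1| <= M /\ `|x.2| <= M.

Definition int_polygon (n : nat) (p : nat -> pt) : set pt :=
  [set x | ~ polygon n p x /\ bounded_set2 (connected_component (~` polygon n p) x)].
Definition ext_polygon (n : nat) (p : nat -> pt) : set pt :=
  [set x | ~ polygon n p x /\ ~ bounded_set2 (connected_component (~` polygon n p) x)].

Definition polpath (S : set pt) (a b : pt) (k : nat) : Prop :=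
  exists s : seq pt, size s = k.+1 /\ head a s = a /\ last a s = b /\
    forall i, (i < k)%N -> segment (nth a s i) (nth a s i.+1) `<=` S.

(* pi_S(a,b): least number of edges (+oo if none) *)
Definition pi_S (S : set pt) (a b : pt) : \bar R :=
  ereal_inf [set (k%:R)%:E | k in polpath S a b].

Definition poldiam (S : set pt) : \bar R :=
  ereal_sup [set pi_S S a b | a in S & b in S].

End Defs.

(* Main.v *)
(* Push the vertex p_i to q_i(e) = p_i + e w_i, where w_i points to the left of
   both edges at p_i.  For small e <> 0 the closed curve q(e) misses P, and the
   sign of e selects the side of P on which it runs.  The first point x of P met
   when walking from a point a off P is either a vertex or inside an edge, and a
   discussion of signs of determinants shows that a sees the point of q(e) that
   is close to x, for one of the two signs.  Two points seeing the same side are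
   therefore joined by 1 + (arc of q(e)) + 1 edges, and the shorter of the two
   arcs uses at most n/2 + 1 edges.

   It remains to exclude that two points of the same region see different sides.
   Every point off P sees one of the two sides, so in that case all points off P
   would lie in that region.  For int P this fails far away.  For ext P it fails
   because the parity of the number of edges crossed by a ray is locally constant
   off P, vanishes on ext P, and differs across an edge. *)

Require Import Defs.
From HB Require Import structures.
From mathcomp Require Import all_boot all_order all_algebra.
From mathcomp Require Import all_classical all_reals all_analysis.
From mathcomp Require Import ring lra zify.
Set Implicit Arguments. Unset Strict Implicit. Unset Printing Implicit Defensive.
Import Order.TTheory GRing.Theory Num.Theory.
Import numFieldNormedType.Exports.
Local Open Scope classical_set_scope.
Local Open Scope ring_scope.

(** * Segments *)
Section Points.
Context {R : realType}.
Notation pt := (R * R)%type.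
Implicit Types (A B C D a b x y z w : pt) (r s t e : R).

Definition lerp t A B : pt :=
  ((1 - t) * A.1 + t * B.1, (1 - t) * A.2 + t * B.2).

Definition shift e A w : pt := (A.1 + e * w.1, A.2 + e * w.2).

(** The determinant of [B - A] and [w], positive when [w] points to the left of [AB]. *)
Definition cross A B w : R := (B.1 - A.1) * w.2 - (B.2 - A.2) * w.1.

(** Twice the signed area of the triangle [A B x]. *)
Definition orient A B x : R := cross A B (x.1 - A.1, x.2 - A.2).

Lemma pt_eq x y : x.1 = y.1 -> x.2 = y.2 -> x = y.
Proof. by case: x y => ? ? [? ?] /= -> ->. Qed.

Lemma lerp0 A B : lerp 0 A B = A.
Proof. by apply: pt_eq => /=; ring. Qed.

Lemma lerp1 A B : lerp 1 A B = B.
Proof. by apply: pt_eq => /=; ring. Qed.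

Lemma shift_lerp e t A B wA wB :
  shift e (lerp t A B) (lerp t wA wB) = lerp t (shift e A wA) (shift e B wB).
Proof. by apply: pt_eq => /=; ring. Qed.

Lemma segment_lerp t A B : 0 <= t <= 1 -> segment A B (lerp t A B).
Proof. by exists t. Qed.

Lemma segmentl A B : segment A B A.
Proof. by rewrite -{2}(lerp0 A B); apply: segment_lerp; lra. Qed.

Lemma segmentr A B : segment A B B.
Proof. by rewrite -{2}(lerp1 A B); apply: segment_lerp; lra. Qed.

Lemma segmentC A B : segment A B = segment B A.
Proof.
apply/seteqP; split => x [t [t01 ->]]; exists (1 - t);
  by split; [lra|apply: pt_eq => /=; ring].
Qed.

Lemma segment_sub A B x y :
  segment A B x -> segment A B y -> segment x y `<=` segment A B.
Proof.
move=> [r [r01 ->]] [s [s01 ->]] z [t [t01 ->]].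
exists ((1 - t) * r + t * s); split; first by nra.
by apply: pt_eq => /=; ring.
Qed.

Lemma cvg_pt (T : Type) (F : set_system T) (FF : Filter F) (f g : T -> R) a :
  f x @[x --> F] --> a.1 -> g x @[x --> F] --> a.2 ->
  (f x, g x) @[x --> F] --> a.
Proof. by case: a => a1 a2 /= fa ga; exact: cvg_pair fa ga. Qed.

Lemma continuous_fst : continuous (fun x : pt => x.1).
Proof. by case=> x1 x2; exact: cvg_fst. Qed.

Lemma continuous_snd : continuous (fun x : pt => x.2).
Proof. by case=> x1 x2; exact: cvg_snd. Qed.

Lemma cvg_lerp (T : Type) (F : set_system T) (FF : Filter F)
    (h : T -> R) (f g : T -> pt) t a b :
  h x @[x --> F] --> t -> f x @[x --> F] --> a -> g x @[x --> F] --> b ->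
  lerp (h x) (f x) (g x) @[x --> F] --> lerp t a b.
Proof.
move=> ht fa gb; apply: cvg_pt => /=; apply: cvgD; apply: cvgM => //;
  try (by apply: cvgB => //; exact: cvg_cst).
- exact: (cvg_comp _ _ fa (@continuous_fst a)).
- exact: (cvg_comp _ _ gb (@continuous_fst b)).
- exact: (cvg_comp _ _ fa (@continuous_snd a)).
- exact: (cvg_comp _ _ gb (@continuous_snd b)).
Qed.

Lemma continuous_lerp_param A B : continuous (fun t => lerp t A B).
Proof. by move=> t; apply: cvg_lerp; [exact: cvg_id|exact: cvg_cst..]. Qed.

Lemma segment_image A B : segment A B = (fun t => lerp t A B) @` `[0, 1].
Proof.
apply/seteqP; split => x.
- by move=> [t [t01 ->]]; exists t => //=; rewrite in_itv.
- by move=> [t /=]; rewrite in_itv /= => t01 <-; exists t.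
Qed.

Lemma connected_segment A B : connected (segment A B).
Proof.
rewrite segment_image; apply: connected_continuous_connected.
  exact: segment_connected.
by apply: continuous_subspaceT; exact: continuous_lerp_param.
Qed.

Lemma closed_segment A B : closed (segment A B).
Proof.
apply: compact_closed; first exact: norm_hausdorff.
rewrite segment_image; apply: continuous_compact; last exact: segment_compact.
by apply: continuous_subspaceT; exact: continuous_lerp_param.
Qed.

Lemma near_notin_segment A B x :
  ~ segment A B x -> \forall y \near x, ~ segment A B y.
Proof.
move=> nx; have /(_ x nx) : open (~` segment A B).
  exact: closed_openC (@closed_segment A B).
by [].
Qed.

(** Compactness of the parameter interval [[0, 1]] makes the pointwise neighbourhoods in [e] uniform
    along the moving segment. *)
Lemma near_segment_disjoint A B (f g : R -> pt) :
  continuous f -> continuous g ->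
  (forall x, segment (f 0) (g 0) x -> ~ segment A B x) ->
  \forall e \near 0, forall x, segment (f e) (g e) x -> ~ segment A B x.
Proof.
move=> cf cg dis.
have /compact_near_coveringP cov := @segment_compact R 0 1.
have := cov R (nbhs (0 : R)) (fun e t => ~ segment A B (lerp t (f e) (g e))) _.
case=> [t|d d0 H]; last first.
  exists d => // e /H {}H x [t [t01 ->]].
  by apply: (H t); rewrite /= in_itv.
rewrite /= in_itv /= => t01.
have := near_notin_segment (dis _ (segment_lerp (f 0) (g 0) t01)).
have ch : lerp u.1 (f u.2) (g u.2) @[u --> (t, 0 : R)] --> lerp t (f 0) (g 0).
  apply: cvg_lerp; first exact: cvg_fst.
    apply: (@cvg_comp _ _ _ snd f _ (nbhs (0 : R))); first exact: cvg_snd.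
    exact: cf.
  apply: (@cvg_comp _ _ _ snd g _ (nbhs (0 : R))); first exact: cvg_snd.
  exact: cg.
exact: ch.
Qed.

Lemma continuous_shift A w : continuous (fun e => shift e A w).
Proof.
by move=> e; apply: cvg_pt => /=; (apply: cvgD; first exact: cvg_cst);
  (apply: cvgM; last exact: cvg_cst); exact: cvg_id.
Qed.

Lemma shift0 A w : shift 0 A w = A.
Proof. by apply: pt_eq => /=; ring. Qed.

End Points.

(** * Sides of an edge *)
Section Cone.
Context {R : realType}.
Notation pt := (R * R)%type.
Implicit Types (A B C a x w : pt) (r s t e k : R).

(** The boolean names a side: [0 < signed b e] says that [e] has the sign of side [b]. *)
Definition signed (b : bool) e : R := if b then e else - e.

Lemma orient_lerp_shift A B a x w s e :
  orient A B (lerp s a (shift e x w)) =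
  (1 - s) * orient A B a + s * orient A B x + s * (e * cross A B w).
Proof. by rewrite /orient /cross /=; ring. Qed.

Lemma orient_lerp A B r x y :
  orient A B (lerp r x y) = (1 - r) * orient A B x + r * orient A B y.
Proof. by rewrite /orient /cross /=; ring. Qed.

Lemma orientAl A B : orient A B A = 0.
Proof. by rewrite /orient /cross /=; ring. Qed.

Lemma orientAr A B : orient A B B = 0.
Proof. by rewrite /orient /cross /=; ring. Qed.

Lemma orient_cycle A B C : orient A B C = orient B C A.
Proof. by rewrite /orient /cross /=; ring. Qed.

(** Under the pair [(orient A x, orient x B)], with [k] for [orient A x B], the rays from [x]
    through [B] and [A] become the points [(r k, 0)] and [(0, r k)], [a] becomes [(alpha, beta)],
    and pushing [x] adds [e (cu, cv)]. Let [0 <= k]. If [alpha] and [beta] are positive, [e > 0]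
    keeps both coordinates positive. Otherwise one of them is at most 0, and [e < 0] makes it
    negative, which it never is on the rays. The case [k < 0] is the mirror image. *)
Lemma cone_side_scalar k alpha beta cu cv : 0 < cu -> 0 < cv ->
  exists b, forall e, 0 < signed b e -> forall s, 0 < s <= 1 ->
  forall r, 0 <= r ->
  ~ ((1 - s) * alpha + s * (e * cu) = r * k /\
     (1 - s) * beta + s * (e * cv) = 0) /\
  ~ ((1 - s) * alpha + s * (e * cu) = 0 /\
     (1 - s) * beta + s * (e * cv) = r * k).
Proof.
move=> cu0 cv0.
have pos c s e : 0 < c -> 0 < s -> 0 < e -> 0 < s * (e * c).
  by move=> *; rewrite !mulr_gt0.
have neg c s e : 0 < c -> 0 < s -> 0 < - e -> s * (e * c) < 0.
  by move=> c0 s0 e0; have := pos c s (- e) c0 s0 e0; lra.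
have [k0|k0] := lerP 0 k.
- have [ab|ab] := boolP ((0 < alpha) && (0 < beta)).
  + exists true => e /= e0 s s01 r r0.
    have s0 : 0 < s by lra.
    have := pos cu s e cu0 s0 e0; have := pos cv s e cv0 s0 e0.
    have : 0 <= (1 - s) * alpha by apply: mulr_ge0; lra.
    have : 0 <= (1 - s) * beta by apply: mulr_ge0; lra.
    by split => -[]; lra.
  + exists false => e /= e0 s s01 r r0.
    have s0 : 0 < s by lra.
    have := neg cu s e cu0 s0 e0; have := neg cv s e cv0 s0 e0.
    have : 0 <= r * k by apply: mulr_ge0.
    have [al|al] := lerP alpha 0.
      have : 0 <= (1 - s) * - alpha by apply: mulr_ge0; lra.
      by split => -[]; lra.
    have : 0 <= (1 - s) * - beta by apply: mulr_ge0; lra.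
    by split => -[]; lra.
- have [ab|ab] := boolP ((alpha < 0) && (beta < 0)).
  + exists false => e /= e0 s s01 r r0.
    have s0 : 0 < s by lra.
    have := neg cu s e cu0 s0 e0; have := neg cv s e cv0 s0 e0.
    have : 0 <= (1 - s) * - alpha by apply: mulr_ge0; lra.
    have : 0 <= (1 - s) * - beta by apply: mulr_ge0; lra.
    by split => -[]; lra.
  + exists true => e /= e0 s s01 r r0.
    have s0 : 0 < s by lra.
    have := pos cu s e cu0 s0 e0; have := pos cv s e cv0 s0 e0.
    have : 0 <= r * - k by apply: mulr_ge0; lra.
    have [al|al] := lerP 0 alpha.
      have : 0 <= (1 - s) * alpha by apply: mulr_ge0; lra.
      by split => -[]; lra.
    have : 0 <= (1 - s) * beta by apply: mulr_ge0; lra.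
    by split => -[]; lra.
Qed.

Lemma cone_side A x B w a : 0 < cross A x w -> 0 < cross x B w ->
  (forall r, 0 <= r -> a <> lerp r x A) ->
  (forall r, 0 <= r -> a <> lerp r x B) ->
  exists b, forall e, 0 < signed b e -> forall s, 0 <= s <= 1 ->
  forall r, 0 <= r ->
  lerp s a (shift e x w) <> lerp r x A /\ lerp s a (shift e x w) <> lerp r x B.
Proof.
move=> cA cB aA aB.
have [b side] :=
  cone_side_scalar (orient A x B) (orient A x a) (orient x B a) cA cB.
exists b => e e0 s s01 r r0.
(* The parameter [s = 0] gives [a] itself, which lies on neither ray by hypothesis. *)
have [->|sn0] := eqVneq s 0; first by rewrite lerp0; split; auto.
have s0 : 0 < s <= 1 by lra.
have [nB nA] := side e e0 s s0 r r0.
split => E; [apply: nA|apply: nB];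
  have := congr1 (orient A x) E; have := congr1 (orient x B) E;
  rewrite !orient_lerp_shift !orient_lerp !orientAl !orientAr;
  rewrite ?[orient x B A]orient_cycle ?[orient B A x]orient_cycle; lra.
Qed.

Lemma orient_shift A B x w e :
  orient A B (shift e x w) = orient A B x + e * cross A B w.
Proof. by rewrite /orient /cross /=; ring. Qed.

Lemma cross_lerp A B s w1 w2 :
  cross A B (lerp s w1 w2) = (1 - s) * cross A B w1 + s * cross A B w2.
Proof. by rewrite /cross /=; ring. Qed.

Lemma convex_gt0 s k1 k2 : 0 <= s <= 1 -> 0 < k1 -> 0 < k2 ->
  0 < (1 - s) * k1 + s * k2.
Proof. by move=> s01 k10 k20; nra. Qed.

Lemma near_affine_gt0 k c : 0 < k -> \forall e \near (0 : R), 0 < k + e * c.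
Proof.
move=> k0; have kc : (k + e * c) @[e --> (0 : R)] --> k + 0 * c.
  by apply: cvgD; [exact: cvg_cst|apply: cvgM; [exact: cvg_id|exact: cvg_cst]].
by rewrite mul0r addr0 in kc;
  exact: (@cvgr_gt _ _ (nbhs (0 : R)) _ (fun e => k + e * c) k kc 0 k0).
Qed.

(* The shifted copy of [AB] misses [BC] for one of two reasons: if the polygon
   turns towards the shifted side at [B], the copy stays strictly on one side
   of the line [BC]; otherwise [BC] lies weakly across the line [AB]. *)
Lemma near_side_next A B C wA wB b :
  0 < cross A B wA -> 0 < cross A B wB -> 0 < cross B C wB ->
  \forall e \near (0 : R), 0 < signed b e ->
  forall x, segment (shift e A wA) (shift e B wB) x -> ~ segment B C x.
Proof.
move=> cA cB cC.
have eqs e s r : lerp s (shift e A wA) (shift e B wB) = lerp r B C ->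
    e * ((1 - s) * cross A B wA + s * cross A B wB) = r * orient A B C /\
    (1 - s) * (orient A B C + e * cross B C wA) + s * (e * cross B C wB) = 0.
  rewrite -shift_lerp => E.
  have := congr1 (orient A B) E; have := congr1 (orient B C) E.
  rewrite !orient_shift !cross_lerp !orient_lerp !orientAl !orientAr.
  by rewrite (orient_cycle A B C) => E1 E2; split; lra.
have [K0|K0] := lerP (signed b (orient A B C)) 0.
  near=> e => e0 x [s [s01 ->]] [r [r01 /eqs[E _]]].
  have := convex_gt0 s01 cA cB.
  set c := _ + _ in E *.
  by case: b K0 e0 => /= K0 e0 c0; nra.
apply: (filterS _ (near_affine_gt0 (signed b (cross B C wA)) K0)).
move=> e small e0 x [s [s01 ->]] [r [r01 /eqs[_ E]]].
have := convex_gt0 s01 small (mulr_gt0 e0 cC).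
by case: b K0 e0 small => /= K0 e0 small; lra.
Unshelve. all: by end_near. Qed.

(** Reversing the orientation turns the preceding edge into the following one. Both [w] and [e]
    change sign, so the pushed points stay the same while the side is negated. *)
Lemma near_side_prev A B C wB wC b :
  0 < cross B C wB -> 0 < cross B C wC -> 0 < cross A B wB ->
  \forall e \near (0 : R), 0 < signed b e ->
  forall x, segment (shift e B wB) (shift e C wC) x -> ~ segment A B x.
Proof.
move=> cB cC cA.
pose opp w : pt := (- w.1, - w.2).
have crossN P Q w : cross Q P (opp w) = cross P Q w by rewrite /cross /=; ring.
have shiftN e x w : shift (- e) x (opp w) = shift e x w.
  by apply: pt_eq => /=; ring.
have := @near_side_next C B A (opp wC) (opp wB) (~~ b).
rewrite !crossN => /(_ cC cB cA) near_neg.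
have cN : (- e) @[e --> (0 : R)] --> - (0 : R).
  by apply: cvgN; exact: cvg_id.
rewrite oppr0 in cN.
have {}near_neg : \forall e \near (0 : R), 0 < signed (~~ b) (- e) ->
    forall x, segment (shift (- e) C (opp wC)) (shift (- e) B (opp wB)) x ->
    ~ segment B A x := cN _ near_neg.
apply: (filterS _ near_neg) => e side e0 x.
rewrite segmentC (segmentC A B) -!(shiftN e); apply: side.
by case: (b) e0 => /=; lra.
Qed.

Lemma near_side_self A B wA wB b :
  0 < cross A B wA -> 0 < cross A B wB ->
  forall e, 0 < signed b e ->
  forall x, segment (shift e A wA) (shift e B wB) x -> ~ segment A B x.
Proof.
move=> cA cB e e0 x [s [s01 ->]] [r [_ E]].
have := congr1 (orient A B) E; rewrite -/(lerp _ _ _) -/(lerp _ _ _).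
rewrite -shift_lerp orient_shift cross_lerp !orient_lerp orientAl orientAr.
have := convex_gt0 s01 cA cB; set c := _ + _ => c0 E2.
by case: b e0 => /= e0; nra.
Qed.

(** The open left half-planes of two directions are disjoint only if the second direction is
    opposite to the first, which the condition on the dot product excludes. *)
Lemma common_left A B C : A <> B -> B <> C ->
  (orient A B C = 0 ->
   0 < (B.1 - A.1) * (C.1 - B.1) + (B.2 - A.2) * (C.2 - B.2)) ->
  exists w, 0 < cross A B w /\ 0 < cross B C w.
Proof.
move=> AB BC dot.
have [k0|k0] := eqVneq (orient A B C) 0.
  (* Both edges point the same way, so the left normal of [AB] serves both. *)
  exists (A.2 - B.2, B.1 - A.1); have := dot k0.
  rewrite /cross /= => d; split; last by lra.
  have : (B.1 - A.1 != 0) || (B.2 - A.2 != 0).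
    apply/negPn/negP; rewrite negb_or !negbK !subr_eq0 => /andP[/eqP h1 /eqP h2].
    by apply: AB; apply: pt_eq.
  have := sqr_ge0 (B.1 - A.1); have := sqr_ge0 (B.2 - A.2).
  rewrite !expr2 => s2 s1.
  by case/orP; rewrite -sqrf_eq0 expr2 => h; [have : 0 < (B.1 - A.1) * (B.1 - A.1)|
     have : 0 < (B.2 - A.2) * (B.2 - A.2)]; rewrite ?lt0r ?h //; lra.
have kk : 0 < orient A B C ^+ 2 by rewrite lt0r sqr_ge0 sqrf_eq0 k0.
(* With edge vectors [u], [v] and [k] their determinant, [k (v - u)] has determinant [k ^+ 2] with
   each of them. *)
exists (orient A B C * ((C.1 - B.1) - (B.1 - A.1)),
        orient A B C * ((C.2 - B.2) - (B.2 - A.2))).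
by split; move: kk; congr (0 < _); rewrite /orient /cross /=; ring.
Qed.

End Cone.

(** * Crossing parity of one edge *)
Section Crossing.
Context {R : realType}.
Notation pt := (R * R)%type.
Implicit Types (A B C a x y w : pt) (r s e : R).
Variable t : R.

(** Labels the lines parallel to the rays. The slope [t] stays free so that it can be chosen with
    the first edge transverse to them. *)
Definition proj x : R := x.1 + t * x.2.

(* The ray from [x] in the direction [(- t, 1)], along which [proj] is constant,
   crosses [AB]; the half-open convention at the endpoints makes the parity of
   the number of crossings stable. *)
Definition crosses A B x : bool :=
  ((proj A <= proj x) (+) (proj B <= proj x)) &&
  (orient A B x * (proj B - proj A) < 0).

(** The ray from [x] passes through [A]. *)
Definition above A x : bool := (proj A == proj x) && (x.2 < A.2).

Lemma near_lt0_eq (f : pt -> R) x : {for x, continuous f} -> f x != 0 ->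
  \forall y \near x, (f y < 0) = (f x < 0).
Proof.
move=> cf fx0; have [flt|fgt] := ltrP (f x) 0.
  apply: (filterS _ (@cvgr_lt _ _ (nbhs x) _ f (f x) cf 0 flt)).
  by move=> y ->.
have {}fgt : 0 < f x by rewrite lt_neqAle eq_sym fx0.
apply: (filterS _ (@cvgr_gt _ _ (nbhs x) _ f (f x) cf 0 fgt)) => y fy.
by apply/negbTE; rewrite -leNgt ltW.
Qed.

Lemma continuous_orient A B : continuous (orient A B).
Proof.
move=> x; apply: cvgB; (apply: cvgM; first exact: cvg_cst); apply: cvgB;
  try exact: cvg_cst; exact: continuous_fst || exact: continuous_snd.
Qed.

Lemma continuous_proj : continuous proj.
Proof.
move=> x; apply: cvgD; first exact: continuous_fst.
by apply: cvgM; [exact: cvg_cst|exact: continuous_snd].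
Qed.

Lemma continuous_crossing A B c x :
  {for x, continuous (fun y => orient A B y * c)}.
Proof. by apply: cvgM; [exact: continuous_orient|exact: cvg_cst]. Qed.

Lemma near_proj_le A x : proj A != proj x ->
  \forall y \near x, (proj A <= proj y) = (proj A <= proj x).
Proof.
move=> Ax; have cf : {for x, continuous (fun y => proj y - proj A)}.
  by apply: cvgB; [exact: continuous_proj|exact: cvg_cst].
have := @near_lt0_eq (fun y => proj y - proj A) x cf.
rewrite subr_eq0 eq_sym => /(_ Ax); apply: filterS => y.
by rewrite !subr_lt0 => H; rewrite !leNgt H.
Qed.

(** A crossing can change near [x] only if the ray passes through an endpoint of [AB] and [y] moves
    to the side [proj y < proj x]. The correction is a sum of one term per endpoint, so it will
    cancel around a closed polygon. *)
Lemma near_crosses A B x : ~ segment A B x ->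
  \forall y \near x, crosses A B y =
    crosses A B x (+) (~~ (proj x <= proj y) && (above A x (+) above B x)).
Proof.
move=> nx.
have [eA|neA] := eqVneq (proj A) (proj x); have [eB|neB] := eqVneq (proj B) (proj x).
(* [AB] lies on the line of the ray: its endpoints are both above [x] or both not, since [x] would
   otherwise lie between them. *)
- near=> y; rewrite /crosses /above eA eB lexx !addbb /= eqxx /=.
  suff -> : (x.2 < A.2) = (x.2 < B.2) by rewrite addbb andbF.
  apply/idP/idP => lt1; rewrite ltNge; apply/negP => lt2; apply: nx.
    exists ((A.2 - x.2) / (A.2 - B.2)); split.
      by rewrite divr_ge0 /= ?ler_pdivrMr; lra.
    move: eA eB; rewrite /proj => eA eB.
    have d0 : A.2 - B.2 != 0 by lra.
    apply: pt_eq => /=.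
      have -> : A.1 = x.1 + t * x.2 - t * A.2 by lra.
      have -> : B.1 = x.1 + t * x.2 - t * B.2 by lra.
      by field.
    by field.
  exists ((A.2 - x.2) / (A.2 - B.2)); split.
    by rewrite -(opprB B.2) -(opprB x.2) invrN mulrNN divr_ge0 /= ?ler_pdivrMr; lra.
  move: eA eB; rewrite /proj => eA eB.
  have d0 : A.2 - B.2 != 0 by lra.
  apply: pt_eq => /=.
    have -> : A.1 = x.1 + t * x.2 - t * A.2 by lra.
    have -> : B.1 = x.1 + t * x.2 - t * B.2 by lra.
    by field.
  by field.
(* Only [A] is on the line of the ray, and the sign of the determinant reduces to comparing the
   heights of [x] and [A]. *)
- have D2 : 0 < (proj B - proj A) ^+ 2.
    by rewrite lt0r sqr_ge0 sqrf_eq0 subr_eq0 eA neB.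
  have oE : orient A B x * (proj B - proj A) = (x.2 - A.2) * (proj B - proj A) ^+ 2.
    have E : x.1 = A.1 + t * A.2 - t * x.2 by move: eA; rewrite /proj; lra.
    by rewrite /orient /cross /proj /= E; ring.
  have o0 : orient A B x * (proj B - proj A) != 0.
    rewrite oE; apply: mulf_neq0; last by rewrite gt_eqF.
    rewrite subr_eq0; apply/negP => /eqP E2; apply: nx.
    suff -> : x = A by exact: segmentl.
    by apply: pt_eq => //; move: eA; rewrite /proj E2; lra.
  have ox : (orient A B x * (proj B - proj A) < 0) = (x.2 < A.2).
    by rewrite oE pmulr_llt0 // subr_lt0.
  near=> y; rewrite /crosses /above eA (negbTE neB) eqxx lexx /= addbF.
  have -> : (proj B <= proj y) = (proj B <= proj x).
    by near: y; exact: near_proj_le.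
  have -> : (orient A B y * (proj B - proj x) < 0) = (x.2 < A.2).
    have : (orient A B y * (proj B - proj A) < 0) =
           (orient A B x * (proj B - proj A) < 0).
      by near: y; apply: near_lt0_eq => //; exact: continuous_crossing.
    by rewrite ox eA.
  rewrite eA in ox; rewrite ox.
  by case: (proj x <= proj y); case: (proj B <= proj x); case: (x.2 < A.2).
(* The same with [B] in place of [A]. *)
- have D2 : 0 < (proj B - proj A) ^+ 2.
    by rewrite lt0r sqr_ge0 sqrf_eq0 subr_eq0 eB eq_sym neA.
  have oE : orient A B x * (proj B - proj A) = (x.2 - B.2) * (proj B - proj A) ^+ 2.
    have E : x.1 = B.1 + t * B.2 - t * x.2 by move: eB; rewrite /proj; lra.
    by rewrite /orient /cross /proj /= E; ring.
  have o0 : orient A B x * (proj B - proj A) != 0.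
    rewrite oE; apply: mulf_neq0; last by rewrite gt_eqF.
    rewrite subr_eq0; apply/negP => /eqP E2; apply: nx.
    suff -> : x = B by exact: segmentr.
    by apply: pt_eq => //; move: eB; rewrite /proj E2; lra.
  have ox : (orient A B x * (proj B - proj A) < 0) = (x.2 < B.2).
    by rewrite oE pmulr_llt0 // subr_lt0.
  near=> y; rewrite /crosses /above eB (negbTE neA) eqxx lexx /=.
  have -> : (proj A <= proj y) = (proj A <= proj x).
    by near: y; exact: near_proj_le.
  have -> : (orient A B y * (proj x - proj A) < 0) = (x.2 < B.2).
    have : (orient A B y * (proj B - proj A) < 0) =
           (orient A B x * (proj B - proj A) < 0).
      by near: y; apply: near_lt0_eq => //; exact: continuous_crossing.
    by rewrite ox eB.
  rewrite eB in ox; rewrite ox.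
  by case: (proj x <= proj y); case: (proj A <= proj x); case: (x.2 < B.2).
(* No endpoint is on the line of the ray. If that line separates them, the determinant is nonzero
   because [x] is not on [AB], so its sign is locally constant. *)
- have near_o : \forall y \near x, (proj A <= proj x) (+) (proj B <= proj x) ->
      (orient A B y * (proj B - proj A) < 0) =
      (orient A B x * (proj B - proj A) < 0).
    have [side|_] := boolP ((proj A <= proj x) (+) (proj B <= proj x)); last by near=> y.
    suff o0 : orient A B x * (proj B - proj A) != 0.
      by apply: (filterS _ (near_lt0_eq (@continuous_crossing A B _ x) o0)).
    have D0 : proj B - proj A != 0.
      by apply/negP; rewrite subr_eq0 => /eqP E; rewrite E addbb in side.
    apply: mulf_neq0 => //; apply/negP => /eqP o0; apply: nx.
    (* The parameter of the point of line [AB] with the same [proj] as [x]. *)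
    pose r := (proj x - proj A) / (proj B - proj A).
    have rD : r * (proj B - proj A) = proj x - proj A by rewrite /r divfK.
    have px : x = lerp r A B.
      move: o0 rD D0; rewrite /orient /cross /proj /= => o0 rD D0.
      have ot := congr1 (fun z => t * z) o0.
      have rD1 := congr1 (fun z => (B.1 - A.1) * z) rD.
      have rD2 := congr1 (fun z => (B.2 - A.2) * z) rD.
      by apply: pt_eq => /=; apply: (mulfI D0); lra.
    rewrite px; apply: segment_lerp.
    have {rD}E : proj x = proj A + r * (proj B - proj A) by rewrite rD; lra.
    move: side; rewrite E.
    move: (proj B) (proj A) D0 => b c D0.
    by have [h1|h1] := lerP c (c + r * (b - c)); have [h2|h2] := lerP b (c + r * (b - c));
      move=> // _; apply/andP; split; nra.
  near=> y.
  rewrite /above (negbTE neA) (negbTE neB) /= andbF addbF /crosses.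
  have -> : (proj A <= proj y) = (proj A <= proj x).
    by near: y; exact: near_proj_le.
  have -> : (proj B <= proj y) = (proj B <= proj x).
    by near: y; exact: near_proj_le.
  have : (proj A <= proj x) (+) (proj B <= proj x) ->
      (orient A B y * (proj B - proj A) < 0) =
      (orient A B x * (proj B - proj A) < 0) by near: y.
  by case: (_ (+) _) => //= ->.
Unshelve. all: by end_near. Qed.
End Crossing.

(** * Polygonal paths *)
Section Paths.
Context {R : realType}.
Notation pt := (R * R)%type.
Implicit Types (S Z : set pt) (a b c x y : pt).

Lemma polpath_nil S a : polpath S a a 0.
Proof. by exists [:: a]. Qed.

Lemma polpath_cons S a b c k :
  segment a b `<=` S -> polpath S b c k -> polpath S a c k.+1.
Proof.
move=> abS [s [sz [hd [lst seg]]]]; exists (a :: s).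
case: s sz hd lst seg => //= x s [sz] -> lst seg.
split; first by rewrite sz.
do 2 split => //; case=> [_ //|i ik].
have := seg i ik; rewrite !(set_nth_default a b) //= ?sz ?ltnS //.
exact: ltnW.
Qed.

Lemma polpath_uncons S a c k :
  polpath S a c k.+1 -> exists2 b, segment a b `<=` S & polpath S b c k.
Proof.
move=> [s [sz]]; case: s sz => [|x [|b s]] //= [sz] [-> [lst seg]].
exists b; first exact: (seg 0%N).
exists (b :: s); rewrite /= sz; do 3 split => //.
move=> i ik; have := seg i.+1 ik.
by rewrite -!nth_behead /= !(set_nth_default b a) //= ?sz ?ltnS // ltnW.
Qed.

Lemma polpath0 S a b : polpath S a b 0 -> a = b.
Proof. by move=> [s [sz]]; case: s sz => [|x [|y s]] //= _ [-> [-> _]]. Qed.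

Lemma polpath_trans S a b c k l :
  polpath S a b k -> polpath S b c l -> polpath S a c (k + l).
Proof.
elim: k a => [|k IH] a; first by move=> /polpath0 ->.
move=> /polpath_uncons[x ax xb] bc; rewrite addSn.
exact: polpath_cons ax (IH _ xb bc).
Qed.

Lemma polpath_segment S a b : segment a b `<=` S -> polpath S a b 1.
Proof. by move=> abS; apply: polpath_cons abS (polpath_nil S b). Qed.

Lemma polpath_sym S a b k : polpath S a b k -> polpath S b a k.
Proof.
elim: k a => [|k IH] a; first by move=> /polpath0 ->; exact: polpath_nil.
move=> /polpath_uncons[x ax xb]; rewrite -addn1; apply: polpath_trans (IH _ xb) _.
by apply: polpath_segment; rewrite segmentC.
Qed.

(** Applied with [S] the complement of the polygon and [Z] one of its regions, this turns a path off
    the polygon into a path within the region. *)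
Lemma polpath_invariant S Z a b k :
  (forall x y, Z x -> segment x y `<=` S -> segment x y `<=` Z) ->
  polpath S a b k -> Z a -> polpath Z a b k /\ Z b.
Proof.
move=> closedZ; elim: k a => [|k IH] a ab Za.
  by rewrite -(polpath0 ab); split=> //; exact: polpath_nil.
have [x ax xb] := polpath_uncons ab.
have axZ := closedZ _ _ Za ax.
have [xbZ Zb] := IH x xb (axZ _ (segmentr a x)).
by split=> //; exact: polpath_cons axZ xbZ.
Qed.

Lemma poldiam_le Z (k : nat) :
  (forall a b, Z a -> Z b -> exists2 l, (l <= k)%N & polpath Z a b l) ->
  (poldiam Z <= (k%:R)%:E)%E.
Proof.
move=> H; apply: ge_ereal_sup => _ [a Za [b Zb <-]].
have [l lk ab] := H a b Za Zb.
apply: (@le_trans _ _ (l%:R)%:E); last by rewrite lee_fin ler_nat.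
by apply: ereal_inf_lbound; exists l.
Qed.

End Paths.

(** * The side curves of a polygon *)
Lemma near_lt_forall (T : Type) (F : set_system T) {FF : Filter F} (n : nat)
    (P : nat -> T -> Prop) :
  (forall i, (i < n)%N -> \forall x \near F, P i x) ->
  \forall x \near F, forall i, (i < n)%N -> P i x.
Proof.
move=> H.
have := @filter_forall T 'I_n (fun i => P i) F FF (fun i => H i (ltn_ord i)).
by apply: filterS => x Px i lt_in; exact: (Px (Ordinal lt_in)).
Qed.

Section Sides.
Context {R : realType}.
Notation pt := (R * R)%type.
Variables (n : nat) (p : nat -> pt).
Hypothesis n3 : (3 <= n)%N.
Hypothesis simple : simple_closed_polygon n p.
Implicit Types (i j k m : nat) (a x y : pt) (e s r : R).

Local Notation next i := (i.+1 %% n)%N.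

Definition prev j : nat := if j == 0%N then n.-1 else j.-1.

Lemma nextE i : (i < n)%N -> next i = if i.+1 == n then 0%N else i.+1.
Proof.
by move=> lt_in; case: (i.+1 =P n) => [<-|ne]; [exact: modnn|apply: modn_small; lia].
Qed.

Lemma next_lt i : (next i < n)%N.
Proof. by rewrite ltn_mod; lia. Qed.

Lemma prev_lt j : (j < n)%N -> (prev j < n)%N.
Proof. by rewrite /prev; case: (j =P 0)%N => ?; lia. Qed.

Lemma prevK j : (j < n)%N -> next (prev j) = j.
Proof.
move=> jn; rewrite nextE ?prev_lt // /prev.
by case: (j =P 0)%N => ?; case: eqP => ?; lia.
Qed.

Lemma next_neq i : (i < n)%N -> next i <> i.
Proof. by move=> lt_in; rewrite nextE //; case: eqP => ?; lia. Qed.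

Lemma next2_neq i : (i < n)%N -> next (next i) <> i.
Proof.
move=> lt_in; rewrite (nextE (next_lt i)) (nextE lt_in).
by case: (i.+1 =P n) => ?; case: eqP => ?; lia.
Qed.

Lemma vertex_inj i j : (i < n)%N -> (j < n)%N -> p i = p j -> i = j.
Proof. by case: simple => inj _; exact: inj. Qed.

Lemma edges_meet i j x : (i < n)%N -> (j < n)%N -> i <> j ->
  edge n p i x -> edge n p j x ->
  (j = next i /\ x = p j) \/ (i = next j /\ x = p i).
Proof. by case: simple => _ meet *; exact: meet. Qed.

Lemma edge_sub i : (i < n)%N -> edge n p i `<=` polygon n p.
Proof. by move=> lt_in x ex; exists i. Qed.

Lemma near_notin_polygon x :
  ~ polygon n p x -> \forall y \near x, ~ polygon n p y.
Proof.
move=> nx.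
have each i : (i < n)%N -> \forall y \near x, ~ edge n p i y.
  move=> lt_in; have : ~ edge n p i x by move=> ex; apply: nx; exists i.
  exact: near_notin_segment.
have H : \forall y \near x, forall i, (i < n)%N -> ~ edge n p i y.
  exact: near_lt_forall each.
by apply: (filterS _ H) => y ny [i lt_in]; exact: ny.
Qed.

Lemma closed_polygon : closed (polygon n p).
Proof.
rewrite -(setCK (polygon n p)); apply: open_closedC.
by rewrite openE => x nx; exact: near_notin_polygon.
Qed.

(** When [BC] folds back onto [AB], the far end of the shorter edge lies on the longer one. *)
Lemma antiparallel_overlap (A B C : pt) : A <> B -> orient A B C = 0 ->
  (B.1 - A.1) * (C.1 - B.1) + (B.2 - A.2) * (C.2 - B.2) <= 0 ->
  segment A B C \/ segment B C A.
Proof.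
move=> AB o0 d0.
have uu : 0 < (B.1 - A.1) ^+ 2 + (B.2 - A.2) ^+ 2.
  rewrite lt0r addr_ge0 ?sqr_ge0 // andbT.
  rewrite paddr_eq0 ?sqr_ge0 // !sqrf_eq0 !subr_eq0; apply/negP => /andP[/eqP h1 /eqP h2].
  by apply: AB; apply: pt_eq.
pose u := (B.1 - A.1) ^+ 2 + (B.2 - A.2) ^+ 2.
(* The ratio of [BC] to [BA]: it is nonnegative, and [C = lerp l B A]. *)
pose l := - ((B.1 - A.1) * (C.1 - B.1) + (B.2 - A.2) * (C.2 - B.2)) / u.
have u0 : u != 0 by rewrite gt_eqF.
have lu : l * u = - ((B.1 - A.1) * (C.1 - B.1) + (B.2 - A.2) * (C.2 - B.2)).
  by rewrite /l divfK.
have l0 : 0 <= l by apply: divr_ge0; [lra|exact: ltW].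
have CE : C = lerp l B A.
  have lu1 := congr1 (fun z => (A.1 - B.1) * z) lu.
  have lu2 := congr1 (fun z => (A.2 - B.2) * z) lu.
  have o1 := congr1 (fun z => (A.1 - B.1) * z) o0.
  have o2 := congr1 (fun z => (A.2 - B.2) * z) o0.
  move: lu1 lu2 o1 o2 u0; rewrite /orient /cross /u /= => lu1 lu2 o1 o2 u0.
  by apply: pt_eq => /=; apply: (mulfI u0); lra.
have [l1|l1] := lerP l 1.
  by left; rewrite segmentC CE; apply: segment_lerp; rewrite l0.
right; have lV : l^-1 * l = 1 by rewrite mulVf // gt_eqF //; lra.
have -> : A = lerp l^-1 B C.
  rewrite CE; apply: pt_eq => /=; move: lV; move: (l^-1) => q lV.
    by have := congr1 (fun z => (A.1 - B.1) * z) lV; lra.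
  by have := congr1 (fun z => (A.2 - B.2) * z) lV; lra.
apply: segment_lerp; rewrite invr_ge0 l0 /= invf_le1; lra.
Qed.

Lemma side_directions : exists w : nat -> pt, forall i, (i < n)%N ->
  0 < cross (p i) (p (next i)) (w i) /\ 0 < cross (p i) (p (next i)) (w (next i)).
Proof.
(* The direction is chosen per vertex, for its two incident edges, and read off per edge
   afterwards. *)
have : forall j, exists w : pt, (j < n)%N ->
    0 < cross (p (prev j)) (p j) w /\ 0 < cross (p j) (p (next j)) w.
  move=> j; have [jn|] := boolP (j < n)%N; last by exists (0, 0).
  have pn := prev_lt jn; have pK := prevK jn.
  have nj : p j <> p (next j).
    by move=> /(vertex_inj jn (next_lt j)) /esym; exact: next_neq.
  have pj : p (prev j) <> p j.
    by move=> /(vertex_inj pn jn) E; apply: (next_neq pn); rewrite pK.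
  have pnj : prev j <> j by move=> E; apply: pj; rewrite E.
  suff [w [w1 w2]] : exists w : pt,
      0 < cross (p (prev j)) (p j) w /\ 0 < cross (p j) (p (next j)) w by exists w.
  apply: common_left => // o0; rewrite ltNge; apply/negP => d0.
  have n2 : prev j <> next j.
    by move=> E; apply: (next2_neq jn); rewrite -E pK.
  have E1 x : segment (p (prev j)) (p j) x -> edge n p (prev j) x.
    by rewrite /edge pK.
  (* A fold would make two consecutive edges share a point other than their common vertex. *)
  have [ex|ex] := antiparallel_overlap pj o0 d0.
    have [[_ E]|[/n2 //]] := edges_meet pn jn pnj (E1 _ ex) (segmentr _ _).
    by apply: nj.
  have [[_ E]|[/n2 //]] := edges_meet pn jn pnj (E1 _ (segmentl _ _)) ex.
  by apply: pj.
move=> /choice[w wP]; exists w => i lt_in; split; first by have [] := wP i lt_in.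
have [+ _] := wP _ (next_lt i).
suff -> : prev (next i) = i by [].
rewrite nextE // /prev; case: (i.+1 =P n) => /= ?; lia.
Qed.

Variable w : nat -> pt.
Hypothesis wP : forall i, (i < n)%N ->
  0 < cross (p i) (p (next i)) (w i) /\ 0 < cross (p i) (p (next i)) (w (next i)).

Definition side e i : pt := shift e (p i) (w i).

(** The parameter [s] is fixed before [e], and all small [e] of the right sign are allowed, so that
    a single [e] can later serve two points and the whole curve at once. *)
Definition sees b a i : Prop := exists2 s, 0 <= s <= 1 &
  \forall e \near (0 : R), 0 < signed b e ->
  segment a (lerp s (side e i) (side e (next i))) `<=` ~` polygon n p.

(** An edge against itself or a neighbour is settled by signs of determinants. Any other pair is
    disjoint at [e = 0], and compactness keeps it so for small [e]. *)
Lemma near_side_path b : \forall e \near (0 : R), 0 < signed b e ->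
  forall i, (i < n)%N ->
  segment (side e i) (side e (next i)) `<=` ~` polygon n p.
Proof.
have each i : (i < n)%N -> forall j, (j < n)%N ->
    \forall e \near (0 : R), 0 < signed b e ->
    forall x, segment (side e i) (side e (next i)) x -> ~ edge n p j x.
  move=> lt_in j jn.
  have [wi wi'] := wP lt_in; have [wj wj'] := wP jn.
  have [<-|/eqP nij] := eqVneq i j.
    by near=> e => e0; exact: near_side_self wi wi' e e0.
  have [ji|/eqP nji] := eqVneq j (next i).
    by rewrite ji in wj wj' *; exact: (near_side_next b wi wi' wj).
  have [ij|/eqP nij'] := eqVneq i (next j).
    by rewrite /edge -ij in wj wj' *; exact: (near_side_prev b wi wi' wj').
  have dis x : segment (side 0 i) (side 0 (next i)) x -> ~ edge n p j x.
    rewrite /side !shift0 => ex ey.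
    by have [[]|[]] := edges_meet lt_in jn nij ex ey.
  have ci k : continuous (side^~ k) by exact: continuous_shift.
  have := near_segment_disjoint (ci i) (ci (next i)) dis.
  by apply: filterS => e He _.
have H : \forall e \near (0 : R), forall i, (i < n)%N -> forall j, (j < n)%N ->
    0 < signed b e ->
    forall x, segment (side e i) (side e (next i)) x -> ~ edge n p j x.
  exact: near_lt_forall (fun i lt_in => near_lt_forall (each i lt_in)).
by apply: (filterS _ H) => e He e0 i lt_in x sx [j jn]; exact: He sx.
Unshelve. all: by end_near. Qed.

(** * Visibility of the side curves *)

Lemma first_hit a z : ~ polygon n p a -> polygon n p z ->
  exists2 x, polygon n p x & forall s, 0 <= s < 1 -> ~ polygon n p (lerp s a x).
Proof.
move=> na Pz.
(* The first hit is the least element of the compact set of parameters at which [[a, z]] meets the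
   polygon. *)
pose K := `[0, 1] `&` (fun t => lerp t a z) @^-1` (polygon n p).
have cK : compact K.
  apply: compact_closedI; first exact: segment_compact.
  apply: closed_comp; last exact: closed_polygon.
  by move=> t _; exact: continuous_lerp_param.
have K0 : K !=set0.
  by exists 1; split; [rewrite /= in_itv /=; lra|rewrite /preimage /= lerp1].
have cid : {within K, continuous (fun t : R => t)}.
  by apply: continuous_subspaceT => t; exact: cvg_id.
have [t] := compact_EVT_min K0 cK cid.
rewrite inE => -[/=]; rewrite in_itv /= => t01 Pt tmin.
exists (lerp t a z) => // s s01 Ps.
have t0 : 0 < t.
  rewrite lt0r; case/andP: t01 => -> _; rewrite andbT; apply/negP => /eqP E.
  by move: Pt; rewrite E lerp0.
have E : lerp s a (lerp t a z) = lerp (s * t) a z by apply: pt_eq => /=; ring.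
have : s * t \in K.
  rewrite inE; split; last by rewrite /preimage /= -E.
  by rewrite /= in_itv /=; nra.
by move=> /tmin; nra.
Qed.

(** Edges through [x] are covered by [xA] and [xB], which [cone_side] handles. The other edges miss
    the segment from [a] to [x], hence also its small perturbations. *)
Lemma near_sees_point a x A B u :
  polygon n p x -> (forall s, 0 <= s < 1 -> ~ polygon n p (lerp s a x)) ->
  0 < cross A x u -> 0 < cross x B u ->
  segment A x `<=` polygon n p -> segment x B `<=` polygon n p ->
  (forall j, (j < n)%N -> edge n p j x ->
     forall y, edge n p j y -> segment A x y \/ segment x B y) ->
  exists b, \forall e \near (0 : R), 0 < signed b e ->
  segment a (shift e x u) `<=` ~` polygon n p.
Proof.
move=> Px hit cA cB PA PB local.
(* If [a] were on the ray from [x] through [D], then either [a] would be on the polygon or [D] would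
   be hit before [x], at parameter [1 - r^-1]. *)
have off D r : segment x D `<=` polygon n p -> 0 <= r -> a <> lerp r x D.
  move=> PD r0 E; have [r1|r1] := lerP r 1.
    apply: (hit 0); first by lra.
    by rewrite lerp0; apply: PD; rewrite E; apply: segment_lerp; rewrite r0.
  have rV : r^-1 * r = 1 by rewrite mulVf // gt_eqF //; lra.
  have rV0 : 0 < r^-1 by rewrite invr_gt0; lra.
  apply: (hit (1 - r^-1)); first by nra.
  suff -> : lerp (1 - r^-1) a x = D by apply: PD; exact: segmentr.
  rewrite E; move: rV; move: (r^-1) => q rV; apply: pt_eq => /=.
    by have := congr1 (fun z => (D.1 - x.1) * z) rV; lra.
  by have := congr1 (fun z => (D.2 - x.2) * z) rV; lra.
have [||b avoid] := @cone_side _ A x B u a cA cB.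
- by move=> r; apply: off; rewrite segmentC.
- by move=> r; exact: off.
exists b.
have each j : (j < n)%N -> \forall e \near (0 : R), 0 < signed b e ->
    forall y, segment a (shift e x u) y -> ~ edge n p j y.
  move=> jn.
  have [ex|nx] := pselect (edge n p j x).
    near=> e => e0 y [s [s01 ->]] /(local _ jn ex)[].
      rewrite segmentC => -[r [/andP[r0 _]]].
      by have [+ _] := avoid e e0 s s01 r r0; apply.
    by move=> -[r [/andP[r0 _]]]; have [_] := avoid e e0 s s01 r r0; apply.
  have dis y : segment a (shift 0 x u) y -> ~ edge n p j y.
    rewrite shift0 => -[s [s01 ->]] ey.
    have [s1|s1] := eqVneq s 1; first by apply: nx; move: ey; rewrite s1 -/(lerp _ _ _) lerp1.
    by apply: (hit s); [lra|exact: edge_sub ey].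
  have ca : continuous (fun _ : R => a) by move=> ?; exact: cvg_cst.
  have := near_segment_disjoint ca (@continuous_shift _ x u) dis.
  by apply: filterS => e He _.
have H : \forall e \near (0 : R), forall j, (j < n)%N -> 0 < signed b e ->
    forall y, segment a (shift e x u) y -> ~ edge n p j y.
  exact: near_lt_forall each.
by apply: (filterS _ H) => e He e0 y sy [j jn]; exact: He sy.
Unshelve. all: by end_near. Qed.

Lemma sees_vertex a j : (j < n)%N ->
  (forall s, 0 <= s < 1 -> ~ polygon n p (lerp s a (p j))) ->
  exists b, sees b a j.
Proof.
move=> jn hit.
have pn := prev_lt jn; have pK := prevK jn.
have [wj _] := wP jn; have [_] := wP pn; rewrite pK => wj'.
have Epj : segment (p (prev j)) (p j) = edge n p (prev j) by rewrite /edge pK.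
have [||||b H] := near_sees_point _ hit wj' wj.
- exact: (edge_sub jn (segmentl _ _)).
- by rewrite Epj; exact: edge_sub.
- exact: (@edge_sub j).
- move=> k kn ek y ey.
  have [kj|/eqP kj] := eqVneq k j; first by right; rewrite kj in ey.
  left; rewrite Epj.
  have [[jk _]|[kE pE]] := edges_meet kn jn kj ek (segmentl _ _).
    suff <- : k = prev j by [].
    move: jk; rewrite (nextE kn) /prev.
    by case: eqP => ? ->; rewrite ?eqxx /=; lia.
  by case: kj; apply: (vertex_inj kn jn); rewrite pE.
by exists b, 0; [lra|apply: (filterS _ H) => e He; rewrite lerp0].
Qed.

Lemma sees_some a : ~ polygon n p a -> exists i b, (i < n)%N /\ sees b a i.
Proof.
move=> na; have n0 : (0 < n)%N by lia.
have [x [i /= lt_in ex] hit] := first_hit na (edge_sub n0 (segmentl _ _)).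
have := ex => -[r [r01 xE]]; rewrite -/(lerp r _ _) in xE.
have [r0|r0] := eqVneq r 0.
  rewrite r0 lerp0 in xE; rewrite xE in hit.
  by have [b ?] := sees_vertex lt_in hit; exists i, b.
have [r1|r1] := eqVneq r 1.
  rewrite r1 lerp1 in xE; rewrite xE in hit.
  by have [b ?] := sees_vertex (next_lt i) hit; exists (next i), b; split=> //; exact: next_lt.
have {r0 r1}rI : 0 < r < 1 by lra.
have [wi wi'] := wP lt_in.
have nE : p i <> p (next i).
  by move=> /(vertex_inj lt_in (next_lt i)) /esym; exact: next_neq.
have xni : x <> p i.
  move=> /esym E; rewrite xE in E; apply: nE.
  by have := congr1 fst E; have := congr1 snd E; move=> /= h2 h1; apply: pt_eq; nra.
have xnn : x <> p (next i).
  move=> /esym E; rewrite xE in E; apply: nE.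
  by have := congr1 fst E; have := congr1 snd E; move=> /= h2 h1; apply: pt_eq; nra.
(* Pushing is affine, so [x] pushed along this interpolated direction is the point of parameter [r]
   on the pushed edge. The two pieces of the edge cut at [x] act as the two incident edges. *)
pose u := lerp r (w i) (w (next i)).
have cu : 0 < cross (p i) (p (next i)) u.
  by rewrite cross_lerp; apply: convex_gt0.
have [|||||||b H] := @near_sees_point a x (p i) (p (next i)) u.
- by exists i.
- exact: hit.
- suff -> : cross (p i) x u = r * cross (p i) (p (next i)) u by apply: mulr_gt0; lra.
  by rewrite xE /cross /=; ring.
- suff -> : cross x (p (next i)) u = (1 - r) * cross (p i) (p (next i)) u.
    by apply: mulr_gt0; lra.
  by rewrite xE /cross /=; ring.
- by apply: subset_trans (edge_sub lt_in); exact: segment_sub (segmentl _ _) ex.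
- by apply: subset_trans (edge_sub lt_in); exact: segment_sub ex (segmentr _ _).
- move=> k kn ek y ey.
  have [ki|/eqP ki] := eqVneq k i; last first.
    by have [[_ /xni]|[kE]] := edges_meet kn lt_in ki ek ex => //; rewrite kE => /xnn.
  rewrite ki in ey; case: ey => s [s01 ->]; rewrite -/(lerp s _ _).
  have [sr|sr] := lerP s r.
    left; have -> : lerp s (p i) (p (next i)) = lerp (s / r) (p i) x.
      by rewrite xE; apply: pt_eq => /=; field; lra.
    by apply: segment_lerp; rewrite divr_ge0 ?ler_pdivrMr /=; lra.
  right; have -> : lerp s (p i) (p (next i)) = lerp ((s - r) / (1 - r)) x (p (next i)).
    by rewrite xE; apply: pt_eq => /=; field; lra.
  by apply: segment_lerp; rewrite divr_ge0 ?ler_pdivrMr /=; lra.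
exists i, b; split=> //; exists r; first by lra.
by apply: (filterS _ H) => e He; rewrite -shift_lerp -xE.
Qed.

(** * Paths along a side curve *)

Lemma side_polpath e i m :
  (forall i, (i < n)%N -> segment (side e i) (side e (next i)) `<=` ~` polygon n p) ->
  (i < n)%N -> polpath (~` polygon n p) (side e i) (side e ((i + m) %% n)) m.
Proof.
move=> safe; elim: m i => [|m IH] i lt_in.
  by rewrite addn0 modn_small //; exact: polpath_nil.
apply: polpath_cons (safe i lt_in) _.
by have := IH _ (next_lt i); rewrite modnDml addSnnS.
Qed.

(** The lengths of the two arcs between [i] and [j] add up to [n]; the alternative records the
    direction of the shorter one. *)
Lemma arc_le_half i j : (i < n)%N -> (j < n)%N ->
  exists2 m, (m <= n %/ 2)%N & j = ((i + m) %% n)%N \/ i = ((j + m) %% n)%N.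
Proof.
have shift_eq k d l : (l < n)%N -> (k + d = l \/ k + d = l + n)%N ->
    l = ((k + d) %% n)%N.
  by move=> ln [] ->; rewrite ?modnDr modn_small.
move=> lt_in jn; have [ij|ji] := leqP i j.
  have [h|h] := leqP (j - i) (n %/ 2).
    by exists (j - i)%N => //; left; apply: shift_eq => //; lia.
  by exists (n + i - j)%N; [lia|right; apply: shift_eq => //; lia].
have [h|h] := leqP (i - j) (n %/ 2).
  by exists (i - j)%N => //; right; apply: shift_eq => //; lia.
by exists (n + j - i)%N; [lia|left; apply: shift_eq => //; lia].
Qed.

(** For an arc of [m > 0] steps the edges are: one to the curve, the rest of edge [i], [m - 1] whole
    edges, the beginning of edge [j], and one off the curve, hence [m + 3]. *)
Lemma same_side_polpath b a c i j : (i < n)%N -> (j < n)%N ->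
  sees b a i -> sees b c j ->
  exists2 k, (k <= n %/ 2 + 3)%N & polpath (~` polygon n p) a c k.
Proof.
move=> lt_in jn.
wlog [m mn jE] : a c i j lt_in jn / exists2 m, (m <= n %/ 2)%N & j = ((i + m) %% n)%N.
  move=> H ai cj; have [m mn [jE|iE]] := arc_le_half lt_in jn.
    by apply: (H a c i j) ai cj => //; exists m.
  have [k kn P] := H c a j i jn lt_in (ex_intro2 _ _ m mn iE) cj ai.
  by exists k => //; exact: polpath_sym.
move=> [s s01 near_a] [r r01 near_c].
have [e [e0 [ae [ce safe]]]] : exists e, 0 < signed b e /\
   segment a (lerp s (side e i) (side e (next i))) `<=` ~` polygon n p /\
   segment c (lerp r (side e j) (side e (next j))) `<=` ~` polygon n p /\
   forall i, (i < n)%N ->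
     segment (side e i) (side e (next i)) `<=` ~` polygon n p.
  have [d /= d0 H] := filterI near_a (filterI near_c (near_side_path b)).
  (* Half the radius common to the three neighbourhoods, with the sign of side [b]. *)
  pose e := signed b (d / 2).
  have e0 : 0 < signed b e by rewrite /e; case: (b) => /=; lra.
  exists e; split=> //.
  have de : `|0 - e| < d.
    rewrite sub0r normrN /e.
    by case: (b) => /=; rewrite ?normrN ger0_norm; lra.
  have [H1 [H2 H3]] := H e de.
  by split; [exact: H1|split; [exact: H2|exact: H3]].
exists (m + 3)%N; first by lia.
set ya := lerp s _ _ in ae; set yc := lerp r _ _ in ce.
have sa : segment (side e i) (side e (next i)) ya by exact: segment_lerp.
have sc : segment (side e j) (side e (next j)) yc by exact: segment_lerp.
rewrite segmentC in ce; have end_c := polpath_segment ce.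
rewrite addnC addSn; apply: polpath_cons ae _.
(* For [m = 0] both landing points lie on the same pushed edge, and three edges suffice. *)
case: m mn jE => [|m] mn jE.
  rewrite addn0 modn_small // in jE; rewrite jE in sc end_c.
  apply: polpath_trans (polpath_segment _) end_c.
  by apply: subset_trans (safe i lt_in); exact: segment_sub sa sc.
have first : segment ya (side e (next i)) `<=` ~` polygon n p.
  by apply: subset_trans (safe i lt_in); exact: segment_sub sa (segmentr _ _).
have last : segment (side e j) yc `<=` ~` polygon n p.
  by apply: subset_trans (safe j jn); exact: segment_sub (segmentl _ _) sc.
have := side_polpath m safe (next_lt i).
rewrite modnDml addSnnS -jE => mid.
rewrite add2n -[m.+3]addn2 addSn; apply: polpath_cons first _.
by apply: polpath_trans mid (polpath_cons last end_c).
Qed.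

End Sides.

(** * Crossing parity of a polygon *)
Lemma midpoint_between (R : realFieldType) (u v : R) : u != v ->
  (u <= (u + v) / 2) (+) (v <= (u + v) / 2).
Proof.
move=> /eqP uv.
have [h0|h0] := lerP u ((u + v) / 2); have [h1|h1] := lerP v ((u + v) / 2) => //=.
  by exfalso; apply: uv; lra.
by exfalso; lra.
Qed.

Section Parity.
Context {R : realType}.
Notation pt := (R * R)%type.
Variables (n : nat) (p : nat -> pt) (t : R).
Implicit Types (i j : nat) (x y : pt) (e : R).

Local Notation next i := (i.+1 %% n)%N.

Definition parity x : bool :=
  \big[addb/false]_(i < n) crosses t (p i) (p (next i)) x.

(** Each vertex counts twice, as the start of one edge and the end of another. *)
Lemma cyclic_addb (f : nat -> bool) :
  \big[addb/false]_(i < n) (f i (+) f (next i)) = false.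
Proof.
rewrite big_split /=.
have -> : \big[addb/false]_(i < n) f (next i) = \big[addb/false]_(i < n) f i.
  by rewrite [RHS](reindex_inj (@ordS_inj n)).
by rewrite addbb.
Qed.

Lemma near_parity x : ~ polygon n p x -> \forall y \near x, parity y = parity x.
Proof.
move=> nx.
have each i : (i < n)%N -> \forall y \near x,
    crosses t (p i) (p (next i)) y = crosses t (p i) (p (next i)) x (+)
    (~~ (proj t x <= proj t y) &&
      (above t (p i) x (+) above t (p (next i)) x)).
  move=> lt_in; have nex : ~ segment (p i) (p (next i)) x by move=> ex; apply: nx; exists i.
  exact (near_crosses t nex).
have H : \forall y \near x, forall i, (i < n)%N ->
    crosses t (p i) (p (next i)) y = crosses t (p i) (p (next i)) x (+)
    (~~ (proj t x <= proj t y) &&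
      (above t (p i) x (+) above t (p (next i)) x)).
  exact (near_lt_forall each).
apply: (filterS _ H) => y Hy; rewrite /parity.
under eq_bigr => i _ do rewrite Hy //.
(* The corrections vanish one by one if [proj t x <= proj t y], and cancel cyclically otherwise. *)
rewrite big_split /=; case: (_ <= _) => /=.
  by rewrite [X in _ (+) X]big1 ?addbF.
by rewrite (cyclic_addb (fun i => above t (p i) x)) addbF.
Qed.

(** By local constancy, the two parity classes off the polygon are separated sets. *)
Lemma parity_connected (C : set pt) x y :
  connected C -> C `<=` ~` polygon n p -> C x -> C y -> parity x = parity y.
Proof.
move=> cC CP Cx Cy.
pose U b := [set z : pt | ~ polygon n p z /\ parity z = b].
have disj b : closure (U b) `&` U (~~ b) = set0.
  apply/seteqP; split => // z [clz [nz pz]].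
  have [z' [[_ pz'] E]] := clz _ (near_parity nz).
  by move: pz'; rewrite E pz; case: (b).
have sep : separated (U true) (U false).
  by split; [exact: disj true|rewrite setIC; exact: disj false].
have cover : C `<=` U true `|` U false.
  by move=> z /CP nz; case E : (parity z); [left|right].
by have [H|H] := connected_subset sep cover cC;
  have [_ ->] := H x Cx; have [_ ->] := H y Cy.
Qed.

Lemma parity_segment x y :
  segment x y `<=` ~` polygon n p -> parity x = parity y.
Proof.
by move=> H; apply: (parity_connected (@connected_segment _ x y) H);
  [exact: segmentl|exact: segmentr].
Qed.

Lemma parity_left x :
  (forall i, (i < n)%N -> proj t x < proj t (p i)) -> parity x = false.
Proof.
move=> lo; have lt_next i : (i < n)%N -> (next i < n)%N.
  by move=> lt_in; rewrite ltn_mod; lia.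
by apply: big1 => i _; rewrite /crosses !leNgt !lo ?lt_next.
Qed.

Lemma parity_right x :
  (forall i, (i < n)%N -> proj t (p i) <= proj t x) -> parity x = false.
Proof.
move=> hi; have lt_next i : (i < n)%N -> (next i < n)%N.
  by move=> lt_in; rewrite ltn_mod; lia.
by apply: big1 => i _; rewrite /crosses !hi ?lt_next.
Qed.

(** Convexity puts the polygon and the segment into complementary half-planes. *)
Lemma halfplane_segment (c1 c2 M : R) x y :
  (forall i, (i < n)%N -> c1 * (p i).1 + c2 * (p i).2 <= M) ->
  M < c1 * x.1 + c2 * x.2 -> M < c1 * y.1 + c2 * y.2 ->
  segment x y `<=` ~` polygon n p.
Proof.
move=> le_M Mx My _ [s [s01 ->]] [i /= lt_in [r [r01 [E1 E2]]]].
have ini : (next i < n)%N by rewrite ltn_mod; lia.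
have hi := le_M i lt_in; have hi' := le_M _ ini.
have : M < (1 - s) * (c1 * x.1 + c2 * x.2) + s * (c1 * y.1 + c2 * y.2).
  rewrite -subr_gt0 in Mx; rewrite -subr_gt0 in My.
  by have := convex_gt0 s01 Mx My; lra.
have -> : (1 - s) * (c1 * x.1 + c2 * x.2) + s * (c1 * y.1 + c2 * y.2) =
  (1 - r) * (c1 * (p i).1 + c2 * (p i).2) +
  r * (c1 * (p (next i)).1 + c2 * (p (next i)).2).
  have F1 := congr1 (fun z => c1 * z) E1; have F2 := congr1 (fun z => c2 * z) E2.
  by lra.
move: (c1 * (p i).1 + _) (c1 * (p (next i)).1 + _) hi hi' => u v hi hi'.
by nra.
Qed.

Lemma vertex_bound : exists2 M, 0 < M & forall i, (i < n)%N ->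
  `|(p i).1| <= M /\ `|(p i).2| <= M.
Proof.
elim: n => [|m [M M0 IH]]; first by exists 1.
exists (M + `|(p m).1| + `|(p m).2|); first by rewrite !ltr_wpDr.
move=> i; rewrite ltnS leq_eqVlt => /orP[/eqP ->|/IH[h1 h2]].
  have := normr_ge0 (p m).1; have := normr_ge0 (p m).2; lra.
have := normr_ge0 (p m).1; have := normr_ge0 (p m).2; lra.
Qed.

(** An unbounded component leaves the square of half-side [M] around the vertices. From there a
    segment off the polygon leads to a point whose [proj] lies beyond those of all vertices, where
    no edge is crossed. *)
Lemma parity_ext x : 0 <= t <= 1 -> ext_polygon n p x -> parity x = false.
Proof.
move=> t01 [nx unbounded]; have [M M0 bound] := vertex_bound.
have bnd i : (i < n)%N -> (- M <= (p i).1 <= M) /\ (- M <= (p i).2 <= M).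
  by move=> /bound; rewrite !ler_norml.
have [y Cy far] : exists2 y, connected_component (~` polygon n p) x y &
    M < `|y.1| \/ M < `|y.2|.
  apply: contrapT => nfar; apply: unbounded; exists M => y Cy.
  by rewrite !leNgt; split; apply/negP => lt_M; apply: nfar; exists y; auto.
have -> : parity x = parity y.
  apply: (parity_connected (@component_connected _ _ x)) Cy.
    exact: connected_component_sub.
  exact: connected_component_refl.
have low z : proj t z < - M - t * M -> parity z = false.
  by move=> zM; apply: parity_left => i /bnd[h1 h2]; rewrite /proj in zM *; nra.
have high z : M + t * M <= proj t z -> parity z = false.
  by move=> zM; apply: parity_right => i /bnd[h1 h2]; rewrite /proj in zM *; nra.
case: far; rewrite ltr_normr => /orP[yM|yM].
(* On the square [proj] is at most [2 * M] in absolute value, as [t <= 1]. The abscissa [3 * M + 5]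
   exceeds this even after a contribution [t * (M + 1)] of the ordinate. *)
- rewrite (@parity_segment y (3 * M + 5, 0));
    first by apply: high; rewrite /proj /=; nra.
  by apply: (@halfplane_segment 1 0 M) => [i /bnd[h1 h2]||] /=; lra.
- rewrite (@parity_segment y (- (3 * M + 5), 0));
    first by apply: low; rewrite /proj /=; nra.
  by apply: (@halfplane_segment (-1) 0 M) => [i /bnd[h1 h2]||] /=; lra.
- rewrite (@parity_segment y (- (3 * M + 5), M + 1));
    first by apply: low; rewrite /proj /=; nra.
  by apply: (@halfplane_segment 0 1 M) => [i /bnd[h1 h2]||] /=; lra.
- rewrite (@parity_segment y (- (3 * M + 5), - (M + 1)));
    first by apply: low; rewrite /proj /=; nra.
  by apply: (@halfplane_segment 0 (-1) M) => [i /bnd[h1 h2]||] /=; lra.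
Qed.

(** The horizontal ray from [(M + 1, 0)] avoids the polygon and makes the component of its origin
    unbounded. *)
Lemma exists_ext : exists x, ext_polygon n p x.
Proof.
have [M M0 bound] := vertex_bound.
have ray c : M < c -> segment (M + 1, 0) (c, 0) `<=` ~` polygon n p.
  move=> Mc; apply: (@halfplane_segment 1 0 M) => /=; try lra.
  by move=> i /bound[]; rewrite ler_norml; lra.
exists (M + 1, 0); split.
  by apply: (ray (M + 1)); [lra|exact: segmentl].
move=> [N /(_ (M + 1 + `|N|, 0))[]].
  exists (segment (M + 1, 0) (M + 1 + `|N|, 0)); last exact: segmentr.
  split; [exact: segmentl| |exact: connected_segment].
  by apply: ray; have := normr_ge0 N; lra.
move=> /= + _; have := ler_norm N; have := ler_norm (M + 1 + `|N|); lra.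
Qed.

Hypothesis simple : simple_closed_polygon n p.
Hypothesis n3 : (3 <= n)%N.

(** The two points lie just above and just below the midpoint of the first edge on a line parallel
    to the rays, so only the crossing of that edge differs. *)
Lemma parity_flip : proj t (p 0%N) != proj t (p 1%N) ->
  exists x y, [/\ ~ polygon n p x, ~ polygon n p y & parity x <> parity y].
Proof.
move=> p01; have n1 : next 0 = 1%N by rewrite modn_small //; lia.
have n0 : (0 < n)%N by lia.
pose m := lerp 2^-1 (p 0%N) (p 1%N).
have m0 : edge n p 0 m by rewrite /edge n1; apply: segment_lerp; lra.
have nE : p 0%N <> p 1%N by move=> E; move: p01; rewrite E eqxx.
(* Other edges meet the first one only in its endpoints, never in its midpoint. *)
have nm j : (j < n)%N -> j <> 0%N -> ~ edge n p j m.
  move=> jn j0 ej; apply: nE.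
  have [[_ E]|[E0 E]] := edges_meet simple jn n0 j0 ej m0.
    by have := congr1 fst E; have := congr1 snd E; move=> /= h2 h1; apply: pt_eq; lra.
  rewrite n1 in E0; rewrite E0 in E.
  by have := congr1 fst E; have := congr1 snd E; move=> /= h2 h1; apply: pt_eq; lra.
(* Along the ray direction [proj] is constant, which kills the corrections in [near_crosses], while
   the determinant becomes [e * D] and changes sign with [e]. *)
pose v : pt := (- t, 1).
have projv e : proj t (shift e m v) = proj t m by rewrite /proj /=; ring.
pose D := proj t (p 1%N) - proj t (p 0%N).
have D2 : 0 < D ^+ 2 by rewrite lt0r sqr_ge0 sqrf_eq0 subr_eq0 eq_sym p01.
have orientv e : orient (p 0%N) (p 1%N) (shift e m v) = e * D.
  by rewrite /orient /cross /D /proj /=; field.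
have each j : (j < n)%N -> \forall y \near m, j <> 0%N ->
    ~ edge n p j y /\ crosses t (p j) (p (next j)) y =
    crosses t (p j) (p (next j)) m (+) (~~ (proj t m <= proj t y) &&
      (above t (p j) m (+) above t (p (next j)) m)).
  move=> jn; have [->|/eqP j0] := eqVneq j 0%N; first by near=> y.
  have nex : ~ segment (p j) (p (next j)) m := nm j jn j0.
  near=> y => _; split; first by near: y; exact (near_notin_segment nex).
  by near: y; exact (near_crosses t nex).
have H : \forall y \near m, forall j, (j < n)%N -> j <> 0%N ->
    ~ edge n p j y /\ crosses t (p j) (p (next j)) y =
    crosses t (p j) (p (next j)) m (+) (~~ (proj t m <= proj t y) &&
      (above t (p j) m (+) above t (p (next j)) m)).
  exact (near_lt_forall each).
have sh : shift e m v @[e --> (0 : R)] --> m.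
  by rewrite -{2}(shift0 m v); exact: continuous_shift.
have [d /= d0 {}H] := sh _ H.
have off e : `|e| < d -> e != 0 -> ~ polygon n p (shift e m v).
  move=> ed e0 [j jn ej]; have [j0|/eqP j0] := eqVneq j 0%N.
    move: ej; rewrite j0 /edge n1 => -[s [s01 E]].
    have := orientv e; rewrite E -/(lerp _ _ _) orient_lerp orientAl orientAr.
    move: e0; rewrite -sqrf_eq0 => e0 /esym/eqP; rewrite !mulr0 addr0 mulf_eq0.
    by rewrite -sqrf_eq0 (negbTE e0) /= -sqrf_eq0 gt_eqF.
  have [] := H e _ j jn j0; first by rewrite /= sub0r normrN.
  by move=> /(_ ej).
have par e : `|e| < d -> parity (shift e m v) = (e < 0) (+)
    \big[addb/false]_(i < n | i != Ordinal n0) crosses t (p i) (p (next i)) m.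
  move=> ed; rewrite /parity (bigD1 (Ordinal n0)) //=; congr addb.
    rewrite n1 /crosses orientv projv -mulrA -expr2 pmulr_llt0 //.
    suff -> : (proj t (p 0%N) <= proj t m) (+) (proj t (p 1%N) <= proj t m) by [].
    have -> : proj t m = (proj t (p 0%N) + proj t (p 1%N)) / 2.
      by rewrite /proj /=; field.
    exact: midpoint_between.
  apply: eq_bigr => i i0; have [] := H e _ i (ltn_ord i).
  - by rewrite /= sub0r normrN.
  - by move=> E; move: i0; rewrite -val_eqE /= E.
  - by move=> _ ->; rewrite projv lexx addbF.
exists (shift (d / 2) m v), (shift (- (d / 2)) m v).
have h0 : 0 < d / 2 by rewrite divr_gt0.
have dd : `|d / 2| < d by rewrite gtr0_norm // gtr_pMr // invf_lt1 ?ltr1n.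
have dn : `|- (d / 2)| < d by rewrite normrN.
split; [by apply: off; rewrite ?gt_eqF|by apply: off; rewrite ?oppr_eq0 ?gt_eqF|].
rewrite !par // (lt_gtF h0) oppr_lt0 h0.
by case: (\big[_/_]_(_ < _ | _) _).
Unshelve. all: by end_near. Qed.

End Parity.

(** * Invariance of the two regions and the final bounds *)

Lemma connected_component_segment (R : realType) (n : nat) (p : nat -> R * R) x y :
  segment x y `<=` ~` polygon n p -> forall z, segment x y z ->
  connected_component (~` polygon n p) x = connected_component (~` polygon n p) z.
Proof.
move=> H z sz; apply: same_connected_component.
by exists (segment x y) => //; split; [exact: segmentl| |exact: connected_segment].
Qed.

Lemma int_invariant (R : realType) (n : nat) (p : nat -> R * R) x y :
  int_polygon n p x -> segment x y `<=` ~` polygon n p ->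
  segment x y `<=` int_polygon n p.
Proof. by move=> [_ bx] H z sz; split; [exact: H|
  rewrite -(connected_component_segment H sz)]. Qed.

Lemma ext_invariant (R : realType) (n : nat) (p : nat -> R * R) x y :
  ext_polygon n p x -> segment x y `<=` ~` polygon n p ->
  segment x y `<=` ext_polygon n p.
Proof. by move=> [_ bx] H z sz; split; [exact: H|
  rewrite -(connected_component_segment H sz)]. Qed.

Theorem theorem3p1 (R : realType) (n : nat) (p : nat -> (R * R)%type) :
  (3 <= n)%N -> simple_closed_polygon n p ->
  (poldiam (int_polygon n p) <= (((n %/ 2 + 3)%N)%:R)%:E)%E /\
  (poldiam (ext_polygon n p) <= (((n %/ 2 + 3)%N)%:R)%:E)%E.
Proof.
move=> n3 simple; have [w wP] := side_directions n3 simple.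
have see a : ~ polygon n p a -> exists i b, (i < n)%N /\ sees n p w b a i.
  by move=> na; exact: (sees_some n3 simple wP na).
(* A path from [a] to [c] off the polygon cannot leave the region of [a], so sharing a side also
   forces [c] into that region. *)
have within (Z : set (R * R)) a c i j b :
    (forall x y, Z x -> segment x y `<=` ~` polygon n p ->
       segment x y `<=` Z) ->
    (i < n)%N -> (j < n)%N -> sees n p w b a i -> sees n p w b c j -> Z a ->
    (exists2 k, (k <= n %/ 2 + 3)%N & polpath Z a c k) /\ Z c.
  move=> inv lt_in jn sa sc Za.
  have [k kn P] := same_side_polpath n3 simple wP lt_in jn sa sc.
  by have [P' Zc] := polpath_invariant inv P Za; split=> //; exists k.
split; apply: poldiam_le => a c Za Zc;
  have [i [b [lt_in sa]]] := see a Za.1; have [j [b' [jn sc]]] := see c Zc.1.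
- have [bb|bb] := eqVneq b b'.
    rewrite -bb in sc.
    by have [] := within _ a c i j b (@int_invariant R n p) lt_in jn sa sc Za.
  have [z Ez] := exists_ext n p.
  have [l [b'' [ln sz]]] := see z Ez.1.
  have Iz : int_polygon n p z.
    (* Two different booleans exhaust the sides, so [z] shares its side with [a] or with [c]. *)
    have [E|E] : b'' = b \/ b'' = b' by case: (b) (b') (b'') bb => [] [] [] //; auto.
      rewrite E in sz.
      by have [] := within _ a z i l b (@int_invariant R n p) lt_in ln sa sz Za.
    rewrite E in sz.
    by have [] := within _ c z j l b' (@int_invariant R n p) jn ln sc sz Zc.
  by case: (Ez.2 Iz.2).
- have [bb|bb] := eqVneq b b'.
    rewrite -bb in sc.
    by have [] := within _ a c i j b (@ext_invariant R n p) lt_in jn sa sc Za.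
  have ext z : ~ polygon n p z -> ext_polygon n p z.
    move=> nz; have [l [b'' [ln sz]]] := see z nz.
    have [E|E] : b'' = b \/ b'' = b' by case: (b) (b') (b'') bb => [] [] [] //; auto.
      rewrite E in sz.
      by have [] := within _ a z i l b (@ext_invariant R n p) lt_in ln sa sz Za.
    rewrite E in sz.
    by have [] := within _ c z j l b' (@ext_invariant R n p) jn ln sc sz Zc.
  (* Vertical rays, [t = 0], work unless the first edge is vertical; its endpoints then differ in
     height and [t = 1] works. *)
  have [t t01 t_proj] : exists2 t : R, 0 <= t <= 1 &
      proj t (p 0%N) != proj t (p 1%N).
    have p01 : p 0%N <> p 1%N.
      by move=> /(vertex_inj simple) E; have : 0%N = 1%N by apply: E; lia.
    have [E|ne] := eqVneq (p 0%N).1 (p 1%N).1; last first.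
      by exists 0; [lra|rewrite /proj !mul0r !addr0].
    exists 1; first by lra.
    rewrite /proj E !mul1r (inj_eq (addrI _)); apply/negP => /eqP E2.
    by apply: p01; exact: pt_eq.
  have [x [y [nx ny]]] := parity_flip simple n3 t_proj.
  by rewrite (parity_ext t01 (ext x nx)) (parity_ext t01 (ext y ny)).
Qed.
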